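(* Let $\mathcal{P}=\{1,\ldots,p\}$, $\lambda\in(0,1)$ and $u_{\max}>0$. Suppose that: (1) for each mode $i\in\mathcal{P}$, the initialization data $(U_-^i,X^i)$ is informative for uniform stabilization by state feedback with decay rate $\lambda$; (2) for each $i\in\mathcal{P}$ the pair $(A_i,B_i)$ is controllable, and $(U_-^i,X^i)$ and $(U_-^j,X^j)$ are incompatible for each pair $i\neq j\in\mathcal{P}$. Then the online data $(U_-^{\mathrm{on}},X^{\mathrm{on}})$ generated by the mode detection algorithm (described in the context), while the system dwells in one mode, together with the initialization data $\{(U_-^i,X^i)\}_{i\in\mathcal{P}}$, are informative for mode detection after at most $n+m$ time instances.
   Context: Setting: a switched linear system $x(t+1)=A_{\sigma(t)}x(t)+B_{\sigma(t)}u(t)$, $x(t)\in\mathbb{R}^n$, $u(t)\in\mathbb{R}^m$, with unknown switching signal $\sigma:\mathbb{N}\to\mathcal{P}$ and unknown matrices $A_i\in\mathbb{R}^{n\times n}$, $B_i\in\mathbb{R}^{n\times m}$. Data: given measurements of state and input on $\{0,\ldots,T\}$, let $X:=[x(0)\ \cdots\ x(T)]$, $U_-:=[u(0)\ \cdots\ u(T-1)]$, $X_+:=[x(1)\ \cdots\ x(T)]$, $X_-:=[x(0)\ \cdots\ x(T-1)]$, and $\Sigma(U_-,X):=\{(A,B)\in\mathbb{R}^{n\times n}\times\mathbb{R}^{n\times m}:X_+=AX_-+BU_-\}$. Superscript $i$ denotes initialization data of mode $i$: noiseless measurements of $x(t+1)=A_ix(t)+B_iu(t)$. Superscript $\mathrm{on}$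 denotes online data: noiseless measurements collected from the running switched system while it dwells in one mode. Definitions: - $(U_-,X)$ is informative for uniform stabilization by state feedback with decay rate $\lambda$ if there exist $K\in\mathbb{R}^{m\times n}$ and $P\in\mathbb{R}^{n\times n}$, $P\succ0$, with $(A+BK)^\top P(A+BK)\preceq\lambda P$ for all $(A,B)\in\Sigma(U_-,X)$. - Two data sets $(U_-,X)$ and $(U_-',X')$ are compatible if $\Sigma(U_-,X)\cap\Sigma(U_-',X')\neq\emptyset$, and incompatible otherwise. - $\{(U_-^i,X^i)\}_{i\in\mathcal{P}}$ and $(U_-^{\mathrm{on}},X^{\mathrm{on}})$ are informative for mode detection if $(U_-^{\mathrm{on}},X^{\mathrm{on}})$ and $(U_-^i,X^i)$ are compatible for exactly one $i\in\mathcal{P}$. Mode detection algorithm. It is started with $X^{\mathrm{on}}$ equal to the current state, $U_-^{\mathrm{on}}$ empty, and $\mathcal{P}_{\mathrm{match}}=\mathcal{P}$. At each time instant $t$, with current state $x(t)$ (the last column of $X^{\mathrm{on}}$): 1. If $U_-^{\mathrm{on}}$ is nonempty and $x(t)\in\operatorname{im}X_-^{\mathrm{on}}$, pick $\begin{bmatrix}\xi \\ \eta\end{bmatrix}\in\ker\begin{bmatrix}X_-^{\mathrm{on}} \\ U_-^{\mathrm{on}}\end{bmatrix}^\top$ with $\eta\neq0$ ($\xi\in\mathbb{R}^n$, $\eta\in\mathbb{R}^m$) and let $u(t)\in\mathbb{R}^m$ be such that $|u(t)|\leq u_{\max}$ and $\xi^\top x(t)+\eta^\top u(t)\neq0$.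 Otherwise let $u(t)=0$. 2. Apply $u(t)$, obtain the next state $x(t+1)$, and append $u(t)$ as a new last column of $U_-^{\mathrm{on}}$ and $x(t+1)$ as a new last column of $X^{\mathrm{on}}$. 3. Remove from $\mathcal{P}_{\mathrm{match}}$ every $i\in\mathcal{P}$ for which the inclusion $\ker\begin{bmatrix} X^i_- & X^{\mathrm{on}}_- \\ U^i_- & U^{\mathrm{on}}_- \end{bmatrix}\subseteq\ker\begin{bmatrix}X^i_+ & X^{\mathrm{on}}_+\end{bmatrix}$ is violated. The algorithm is executed once per time instant, until $\mathcal{P}_{\mathrm{match}}$ is a singleton. ''After at most $n+m$ time instances'' means after at most $n+m$ such executions.
   Formalization: If the algorithm starts at the zero state, the bound is n+m+1 time instances instead of n+m: the first execution then applies u=0 and records only a zero column, and n+m can fail (e.g. n=m=1, A_1=0, A_2=1/2, B_1=B_2=1); for a nonzero initial state the bound is n+m. *)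

(* Defs.v *)
From mathcomp Require Import all_boot all_order all_algebra.
From mathcomp Require Import reals.

Set Implicit Arguments.
Unset Strict Implicit.
Unset Printing Implicit Defensive.

Import Order.TTheory GRing.Theory Num.Theory.
Local Open Scope ring_scope.

Definition enorm (R : realType) (q : nat) (v : 'cV[R]_q) : R :=
  Num.sqrt (\sum_i v i 0 ^+ 2).

Definition posdef (R : realType) (q : nat) (P : 'M[R]_q) : Prop :=
  P^T = P /\ forall v : 'cV[R]_q, v != 0 -> 0 < (v^T *m P *m v) 0 0.

Definition possemidef (R : realType) (q : nat) (P : 'M[R]_q) : Prop :=
  P^T = P /\ forall v : 'cV[R]_q, 0 <= (v^T *m P *m v) 0 0.

Definition loewner_le (R : realType) (q : nat) (P Q : 'M[R]_q) : Prop :=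
  possemidef (Q - P).

(* Every state can be steered to every other state in finite time. *)
Definition controllable (R : realType) (n m : nat)
    (A : 'M[R]_n) (B : 'M[R]_(n, m)) : Prop :=
  forall x0 x1 : 'cV[R]_n,
    exists (T : nat) (x : nat -> 'cV[R]_n) (u : nat -> 'cV[R]_m),
      [/\ x 0 = x0, x T = x1
        & forall t, (t < T)%N -> x t.+1 = A *m x t + B *m u t].

(* Measurements on {0, ..., T}, with T = dlen:
   dU = [u(0) ... u(T-1)] and dX = [x(0) ... x(T)]. *)
Record data (R : realType) (n m : nat) := Data {
  dlen : nat;
  dU : 'M[R]_(m, dlen);
  dX : 'M[R]_(n, dlen.+1) }.

(* [x(0) ... x(T-1)] and [x(1) ... x(T)]: dX without its last, resp. first,
   column. *)
Definition Xminus (R : realType) (n m : nat) (D : data R n m) :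
  'M[R]_(n, dlen D) := col' ord_max (dX D).

Definition Xplus (R : realType) (n m : nat) (D : data R n m) :
  'M[R]_(n, dlen D) := col' ord0 (dX D).

(* The systems (A, B) that explain the data. *)
Definition Sigma (R : realType) (n m : nat) (D : data R n m)
    (A : 'M[R]_n) (B : 'M[R]_(n, m)) : Prop :=
  Xplus D = A *m Xminus D + B *m dU D.

Definition informative_stabilization (R : realType) (n m : nat)
    (lambda : R) (D : data R n m) : Prop :=
  exists (K : 'M[R]_(m, n)) (P : 'M[R]_n),
    posdef P /\
    forall A B, Sigma D A B ->
      loewner_le ((A + B *m K)^T *m P *m (A + B *m K)) (lambda *: P).

Definition compatible (R : realType) (n m : nat) (D D' : data R n m) : Prop :=
  exists A B, Sigma D A B /\ Sigma D' A B.

Definition informative_mode_detection (R : realType) (n m p : nat)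
    (D : 'I_p -> data R n m) (Don : data R n m) : Prop :=
  exists! i : 'I_p, compatible Don (D i).

(* The data collected from the trajectory (x, u) after k executions of an
   algorithm started at time t0. *)
Definition online (R : realType) (n m : nat)
    (x : nat -> 'cV[R]_n) (u : nat -> 'cV[R]_m) (t0 k : nat) : data R n m :=
  Data (\matrix_(i < m, j < k) u (t0 + j)%N i 0)
       (\matrix_(i < n, j < k.+1) x (t0 + j)%N i 0).

(* The inputs v that step 1 may select from online data D. As %MS speaks of row
   spaces, x^T <= X^T means that x is in the column space of X. *)
Definition input_rule (R : realType) (n m : nat) (umax : R)
    (D : data R n m) (v : 'cV[R]_m) : Prop :=
  let x := col ord_max (dX D) in
  if (0 < dlen D)%N && (x^T <= (Xminus D)^T)%MS then
    exists (xi : 'cV[R]_n) (eta : 'cV[R]_m),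
      [/\ (col_mx (Xminus D) (dU D))^T *m col_mx xi eta = 0,
          eta != 0,
          enorm v <= umax
        & (xi^T *m x + eta^T *m v) 0 0 != 0]
  else v = 0.

(* The kernel inclusion of step 3, for right kernels: kermx M^T is the right
   kernel of M, with transposed elements. *)
Definition kernel_test (R : realType) (n m : nat) (D Don : data R n m) : bool :=
  (kermx (block_mx (Xminus D) (Xminus Don) (dU D) (dU Don))^T
     <= kermx (row_mx (Xplus D) (Xplus Don))^T)%MS.

(* N executions of the mode detection algorithm, started at time t0, on the
   switched system (A, B) with switching signal sigma. match_ k is P_match after
   k executions. *)
Record mode_detection_run (R : realType) (n m p : nat)
    (A : 'I_p -> 'M[R]_n) (B : 'I_p -> 'M[R]_(n, m)) (sigma : nat -> 'I_p)
    (D : 'I_p -> data R n m) (umax : R) (t0 N : nat)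
    (x : nat -> 'cV[R]_n) (u : nat -> 'cV[R]_m) (match_ : nat -> {set 'I_p}) :
    Prop := ModeDetectionRun {
  run_init : match_ 0 = [set: 'I_p];
  run_continue : forall k, (k < N)%N -> #|match_ k| <> 1;
  run_input : forall k, (k < N)%N ->
    input_rule umax (online x u t0 k) (u (t0 + k)%N);
  run_state : forall k, (k < N)%N ->
    x (t0 + k).+1 = A (sigma (t0 + k)%N) *m x (t0 + k)%N
                  + B (sigma (t0 + k)%N) *m u (t0 + k)%N;
  run_match : forall k, (k < N)%N ->
    match_ k.+1 =
      [set i in match_ k | kernel_test (D i) (online x u t0 k.+1)] }.

(* Main.v *)
Require Import Defs.
From mathcomp Require Import all_boot all_order all_algebra.
From mathcomp Require Import reals.

Set Implicit Arguments.
Unset Strict Implicit.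
Unset Printing Implicit Defensive.

Import Order.TTheory GRing.Theory Num.Theory.
Local Open Scope ring_scope.

(** Write [M] for the regressor of the online data, the matrix obtained by
stacking the past states on the past inputs, and [s] for the mode in which the
system dwells.

A mode survives the kernel test exactly when its data and the online data are
explained by a common system: the inclusion of right kernels says that both
successor matrices factor through the regressors by one matrix [A B]
([kernel_testP]).  Since shorter online data are explained by more systems, the
set of matches after [k] executions consists of the modes compatible with the
first [k] online samples ([mem_match_compatible]).  It always contains [s], and
being a singleton amounts to informativity for mode detection.

Every input selected by the algorithm adds to [M] a column outside the column
span of [M], except at the very first execution from the zero state
([input_rule_excites]); the rank of [M] therefore grows by one at each
execution ([regressor_online_rank]).  After at most [n + m] effective executions
[M] has full row rank, so the online data determine the system: a matching mode
is compatible with [s], hence equal to [s].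

It remains to see that the algorithm never gets stuck ([input_rule_feasible]).
Suppose that the current state lies in the image of the past states and that
the left kernel of [M] has no element [(xi, eta)] with nonzero [eta].  The
left annihilator of the past states then also annihilates their successors,
which makes it an [A]-invariant space of row vectors killed by [B].
Controllability forces it to vanish, so [M] has full row rank and the mode has
already been identified. *)

(** * Linear algebra *)

(** The rows [z] with [M *m z^T = 0] determine the row space of [M]: by duality,
inclusion of kernels reverses inclusion of row spaces. *)
Lemma kermx_trS (F : fieldType) (a b c : nat)
    (M : 'M[F]_(b, a)) (Y : 'M[F]_(c, a)) :
  (kermx M^T <= kermx Y^T)%MS = (Y <= M)%MS.
Proof.
apply/idP/idP => [sMY | /submxP[Z ->]].
  rewrite submxE -trmx_eq0 trmx_mul; apply/eqP/sub_kermxP.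
  (* The transposed cokernel of M is a left annihilator of M^T. *)
  apply: submx_trans sMY; apply/sub_kermxP.
  by rewrite -trmx_mul mulmx_coker trmx0.
by apply/sub_kermxP; rewrite trmx_mul mulmxA mulmx_ker mul0mx.
Qed.

Lemma eq_col_matrix (T : Type) (a b : nat) (M N : 'M[T]_(a, b)) :
  (forall j, col j M = col j N) -> M = N.
Proof.
by move=> MN; apply/matrixP => i j; have /matrixP/(_ i 0) := MN j; rewrite !mxE.
Qed.

Lemma col_mulmx (R : pzSemiRingType) (a b c : nat)
    (M : 'M[R]_(a, b)) (N : 'M[R]_(b, c)) (j : 'I_c) :
  col j (M *m N) = M *m col j N.
Proof. by rewrite !colE mulmxA. Qed.

Lemma mul_tr_eq0 (R : realType) (q : nat) (v : 'cV[R]_q) :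
  ((v^T *m v) 0 0 == 0) = (v == 0).
Proof.
apply/eqP/eqP => [|->]; last by rewrite mulmx0 mxE.
rewrite mxE => /eqP; rewrite psumr_eq0; last first.
  by move=> i _; rewrite mxE -expr2 sqr_ge0.
move=> /allP v0; apply/matrixP => i j; rewrite ord1 mxE; apply/eqP.
by have := v0 i (mem_index_enum _); rewrite mxE mulf_eq0 orbb.
Qed.

Lemma rank_ltmx_ker (F : fieldType) (a b c : nat)
    (M : 'M[F]_(a, b)) (M' : 'M[F]_(a, c)) :
  (kermx M' < kermx M)%MS -> (\rank M < \rank M')%N.
Proof.
move=> /rank_ltmx; rewrite !mxrank_ker => lt_ker.
by rewrite ltnNge; apply: contraTN lt_ker => le_rk; rewrite -leqNgt leq_sub2l.
Qed.

(** Since [W *m A] is a multiple of [W] and [W *m B = 0], all states reached from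
the origin are annihilated by [W]; by controllability these include the
transposed rows of [W] themselves. *)
Lemma controllable_invariant_eq0 (R : realType) (n m q : nat)
    (A : 'M[R]_n) (B : 'M[R]_(n, m)) (W : 'M[R]_(q, n)) :
  controllable A B -> (W *m A <= W)%MS -> W *m B = 0 -> W = 0.
Proof.
move=> ctrlAB /submxP[Z WA] WB; apply/row_matrixP => i; rewrite row0.
have [T [x [u [x0 xT xS]]]] := ctrlAB 0 (row i W)^T.
have Wx t : (t <= T)%N -> W *m x t = 0.
  elim: t => [|t IHt] tT; first by rewrite x0 mulmx0.
  rewrite xS // mulmxDr !mulmxA WA WB mul0mx addr0.
  by rewrite -mulmxA IHt ?mulmx0 // ltnW.
apply: trmx_inj; rewrite trmx0; apply/eqP; rewrite -mul_tr_eq0 trmxK.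
by rewrite -row_mul -xT Wx // row0 mxE.
Qed.

Lemma enormZ (R : realType) (q : nat) (c : R) (v : 'cV[R]_q) :
  0 <= c -> enorm (c *: v) = c * enorm v.
Proof.
move=> c0; rewrite /enorm -[in RHS](ger0_norm c0) -sqrtr_sqr.
rewrite -sqrtrM ?sqr_ge0 // mulr_sumr; congr Num.sqrt.
by apply: eq_bigr => i _; rewrite mxE exprMn.
Qed.

Lemma enorm0 (R : realType) (q : nat) : enorm (0 : 'cV[R]_q) = 0.
Proof. by rewrite -(scale0r 0) enormZ // mul0r. Qed.

Lemma enorm_gt0 (R : realType) (q : nat) (v : 'cV[R]_q) :
  v != 0 -> 0 < enorm v.
Proof.
move=> v0; rewrite sqrtr_gt0 lt_neqAle eq_sym sumr_ge0 ?andbT; last first.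
  by move=> i _; rewrite sqr_ge0.
have -> : \sum_i v i 0 ^+ 2 = (v^T *m v) 0 0; last by rewrite mul_tr_eq0.
by rewrite mxE; apply: eq_bigr => i _; rewrite mxE expr2.
Qed.

(** * Data and the systems that explain them *)

Definition regressor (R : realType) (n m : nat) (D : data R n m) :
  'M[R]_(n + m, dlen D) := col_mx (Xminus D) (dU D).

Lemma SigmaE (R : realType) (n m : nat) (D : data R n m)
    (A : 'M[R]_n) (B : 'M[R]_(n, m)) :
  Sigma D A B <-> Xplus D = row_mx A B *m regressor D.
Proof. by rewrite mul_row_col. Qed.

(** By duality the test says that the rows of [Xplus D, Xplus Don] are
combinations of the rows of the joint regressor; the coefficients form a common
explanation [row_mx A B]. *)
Lemma kernel_testP (R : realType) (n m : nat) (D Don : data R n m) :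
  reflect (compatible Don D) (kernel_test D Don).
Proof.
rewrite /kernel_test kermx_trS block_mxEh.
apply: (iffP submxP) => [[Z] | [A [B [/SigmaE SDon /SigmaE SD]]]].
  rewrite mul_mx_row -[Z]hsubmxK => /eq_row_mx[SD SDon].
  by exists (lsubmx Z), (rsubmx Z); split; apply/SigmaE.
by exists (row_mx A B); rewrite mul_mx_row SD SDon.
Qed.

Lemma Sigma_unique (R : realType) (n m : nat) (D : data R n m)
    (A A' : 'M[R]_n) (B B' : 'M[R]_(n, m)) :
  row_free (regressor D) -> Sigma D A B -> Sigma D A' B' ->
  A = A' /\ B = B'.
Proof.
by move=> freeD /SigmaE S /SigmaE; rewrite S => /(row_free_inj freeD) /eq_row_mx.
Qed.

(** The columns of [Xplus D] are columns of [Xminus D], or the last state. *)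
Lemma mulmx_Xplus_eq0 (R : realType) (n m q : nat) (D : data R n m)
    (W : 'M[R]_(q, n)) :
  W *m Xminus D = 0 -> W *m col ord_max (dX D) = 0 -> W *m Xplus D = 0.
Proof.
move=> WX Wx; have WdX j : W *m col j (dX D) = 0.
  case: (unliftP ord_max j) => [j' ->|-> //].
  have -> : col (lift ord_max j') (dX D) = col j' (Xminus D).
    by apply/matrixP => a b; rewrite !mxE.
  by rewrite -col_mulmx WX col0.
apply: eq_col_matrix => j; rewrite col_mulmx col0 -[RHS](WdX (lift ord0 j)).
by congr (_ *m _); apply/matrixP => a b; rewrite !mxE.
Qed.

(** * The input rule *)

(** The new column of the regressor is outside its column span, as witnessed by
a left annihilator [w]: the pair [(xi, eta)] of the rule if the current state is
in the image of the past ones, and otherwise [(xi, 0)] with [xi] annihilating the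
past states but not the current one.  The only failure is the zero state without
any past data: the empty matrix already has it in its image, yet the rule asks
for the zero input. *)
Lemma input_rule_excites (R : realType) (n m : nat) (umax : R)
    (D : data R n m) (v : 'cV[R]_m) :
  let x := col ord_max (dX D) in
  input_rule umax D v -> (0 < dlen D)%N || (x != 0) ->
  exists w : 'rV[R]_(n + m),
    w *m regressor D = 0 /\ w *m col_mx x v != 0.
Proof.
rewrite /input_rule; set x := col _ _; case: ifP => [_ | nin].
  move=> [xi [eta [ker _ _ nz]]] _; exists (col_mx xi eta)^T; split.
    by apply: trmx_inj; rewrite trmx_mul trmxK trmx0.
  rewrite tr_col_mx mul_row_col; apply: contraNneq nz => ->.
  by rewrite mxE.
move=> _ pos; have {nin pos} : ~~ (x^T <= (Xminus D)^T)%MS.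
  case: (posnP (dlen D)) nin pos => [len0 _ /= x0 | /= _ -> //].
  have -> : (Xminus D)^T = 0.
    by apply/matrixP => i; have := ltn_ord i; rewrite {2}len0.
  by apply: contraNN x0 => /submx0null/eqP; rewrite trmx_eq0.
rewrite submxE => /matrix0Pn[i [j nz]].
exists (row_mx (col j (cokermx (Xminus D)^T))^T 0).
rewrite !mul_row_col !mul0mx !addr0; split.
  apply: trmx_inj; rewrite trmx0 trmx_mul trmxK -col_mulmx mulmx_coker.
  by rewrite col0.
apply: contraNneq nz => /(congr1 trmx).
rewrite trmx_mul trmxK -col_mulmx trmx0 ord1 => /matrixP/(_ 0 0).
by rewrite mxE [RHS]mxE => ->.
Qed.

(** The left kernel of a regressor without full row rank contains some
[(xi, eta)] with nonzero [eta], as otherwise it would be [(W, 0)] with [W]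
spanning an invariant space that contradicts controllability.  Given such a pair,
either the zero input works, or [xi] annihilates the current state and a multiple
of [eta] of norm [umax] does. *)
Lemma input_rule_feasible (R : realType) (n m : nat) (umax : R)
    (D : data R n m) (A : 'M[R]_n) (B : 'M[R]_(n, m)) :
  0 < umax -> controllable A B -> Sigma D A B -> ~~ row_free (regressor D) ->
  exists v, input_rule umax D v.
Proof.
move=> umax0 ctrlAB SD; rewrite /input_rule; set x := col _ _.
have [/andP[_ xX] deficient | _ _] :=
  boolP ((0 < dlen D)%N && (x^T <= (Xminus D)^T)%MS); last by exists 0.
have ker_x q (W : 'M_(q, n)) : W *m Xminus D = 0 -> W *m x = 0.
  move=> WX; have /submxP[Z xE] := xX.
  by rewrite -[x]trmxK xE trmx_mul trmxK mulmxA WX mul0mx.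
have [xi [eta [ker eta0]]] : exists (xi : 'rV_n) (eta : 'rV_m),
    row_mx xi eta *m regressor D = 0 /\ eta != 0.
  move: deficient; rewrite -kermx_eq0.
  have [K20 | /matrix0Pn[i [j nz]] _] := eqVneq (rsubmx (kermx (regressor D))) 0.
    (* All elements of the left kernel have a zero input part. *)
    set W := lsubmx (kermx (regressor D)).
    have kerE : kermx (regressor D) = row_mx W 0 by rewrite -K20 hsubmxK.
    have WX : W *m Xminus D = 0.
      by have := mulmx_ker (regressor D); rewrite kerE mul_row_col mul0mx addr0.
    suff W0 : W = 0 by rewrite kerE W0 row_mx0 eqxx.
    (* W annihilates Xplus = [A B] * regressor, so [WA WB] lies in the kernel. *)
    have := mulmx_Xplus_eq0 WX (ker_x _ _ WX).
    move/SigmaE: SD => ->; rewrite mulmxA => /sub_kermxP.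
    rewrite kerE mul_mx_row => /submxP[Z]; rewrite mul_mx_row mulmx0.
    case/eq_row_mx => WA WB; apply: (controllable_invariant_eq0 ctrlAB _ WB).
    by rewrite WA submxMl.
  exists (row i (lsubmx (kermx (regressor D)))).
  exists (row i (rsubmx (kermx (regressor D)))); split.
    by rewrite -row_row_mx hsubmxK -row_mul mulmx_ker row0.
  by apply/matrix0Pn; exists 0, j; rewrite mxE.
have [xix | xix] := eqVneq ((xi *m x) 0 0) 0.
  have nz : enorm eta^T != 0 by rewrite gt_eqF // enorm_gt0 ?trmx_eq0.
  have c0 : 0 < umax / enorm eta^T.
    by rewrite divr_gt0 // enorm_gt0 ?trmx_eq0.
  exists ((umax / enorm eta^T) *: eta^T), xi^T, eta^T; split.
  - by rewrite -tr_row_mx -trmx_mul ker trmx0.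
  - by rewrite trmx_eq0.
  - by rewrite (enormZ _ (ltW c0)) divfK.
  rewrite trmxK mxE xix add0r -scalemxAr mxE mulf_eq0.
  by rewrite mul_tr_eq0 trmx_eq0 (gt_eqF c0).
exists 0, xi^T, eta^T; split.
- by rewrite -tr_row_mx -trmx_mul ker trmx0.
- by rewrite trmx_eq0.
- by rewrite enorm0 ltW.
by rewrite trmxK mulmx0 addr0.
Qed.

(** * Online data *)

Lemma Sigma_online (R : realType) (n m : nat) (x : nat -> 'cV[R]_n)
    (u : nat -> 'cV[R]_m) (t0 k : nat) (A : 'M[R]_n) (B : 'M[R]_(n, m)) :
  Sigma (online x u t0 k) A B <->
  forall j, (j < k)%N ->
    x (t0 + j).+1 = A *m x (t0 + j)%N + B *m u (t0 + j)%N.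
Proof.
have XpE (j : 'I_k) : col j (Xplus (online x u t0 k)) = x (t0 + j).+1.
  by apply/matrixP => a b; rewrite !mxE ord1 lift0 addnS.
have XmE (j : 'I_k) : col j (Xminus (online x u t0 k)) = x (t0 + j)%N.
  by apply/matrixP => a b; rewrite !mxE ord1 lift_max.
have UE (j : 'I_k) : col j (dU (online x u t0 k)) = u (t0 + j)%N.
  by apply/matrixP => a b; rewrite !mxE ord1.
split=> [S j jk | S].
  have := congr1 (col (Ordinal jk)) S.
  by rewrite linearD /= !col_mulmx XpE XmE UE.
apply: eq_col_matrix => j.
by rewrite linearD /= !col_mulmx XpE XmE UE S.
Qed.

Lemma mulmx_regressor_online (R : realType) (n m q : nat)
    (x : nat -> 'cV[R]_n) (u : nat -> 'cV[R]_m) (t0 k : nat)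
    (W : 'M[R]_(q, n + m)) :
  W *m regressor (online x u t0 k) = 0 <->
  forall j, (j < k)%N -> W *m col_mx (x (t0 + j)%N) (u (t0 + j)%N) = 0.
Proof.
have colE (j : 'I_k) : col j (regressor (online x u t0 k)) =
    col_mx (x (t0 + j)%N) (u (t0 + j)%N).
  rewrite /regressor col_col_mx; congr col_mx; apply/matrixP => a b.
    by rewrite !mxE ord1 lift_max.
  by rewrite !mxE ord1.
split=> [W0 j jk | W0].
  by rewrite -(colE (Ordinal jk)) -col_mulmx W0 col0.
by apply: eq_col_matrix => j; rewrite col0 col_mulmx colE W0.
Qed.

(** The left kernel of the regressor shrinks strictly at each execution, by the
annihilator that [input_rule_excites] provides.  The summand accounts for the
first execution from the zero state, which appends a zero column. *)
Lemma regressor_online_rank (R : realType) (n m : nat) (umax : R)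
    (x : nat -> 'cV[R]_n) (u : nat -> 'cV[R]_m) (t0 N : nat) :
  (forall k, (k < N)%N ->
     input_rule umax (online x u t0 k) (u (t0 + k)%N)) ->
  forall k, (k <= N)%N ->
  (k <= \rank (regressor (online x u t0 k)) + (x t0 == 0)%R)%N.
Proof.
move=> inp; elim=> [//|k IHk] kN.
have [/andP[/eqP-> /eqP->] | start] := boolP ((k == 0%N) && (x t0 == 0)).
  by rewrite eqxx addn1.
have xE : col ord_max (dX (online x u t0 k)) = x (t0 + k)%N.
  by apply/matrixP => a b; rewrite !mxE ord1.
have pos : (0 < dlen (online x u t0 k))%N
    || (col ord_max (dX (online x u t0 k)) != 0).
  rewrite xE /=; move: start; rewrite negb_and lt0n.
  by case: eqVneq => //= ->; rewrite addn0.
have [w [wker]] := input_rule_excites (inp k kN) pos; rewrite xE => wx.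
apply: leq_ltn_trans (IHk (ltnW kN)) _; rewrite ltn_add2r.
apply: rank_ltmx_ker; apply/andP; split.
  apply/sub_kermxP/mulmx_regressor_online => j jk.
  move/mulmx_regressor_online: (mulmx_ker (regressor (online x u t0 k.+1))).
  by apply; apply: ltnW.
apply: contraNN wx => sub.
have /sub_kermxP/mulmx_regressor_online/(_ k (ltnSn k)) -> // :
  (w <= kermx (regressor (online x u t0 k.+1)))%MS.
by apply: submx_trans sub; apply/sub_kermxP.
Qed.

(** Compatibility with the latest data subsumes all the earlier tests, because a
system explaining the data explains each prefix.  For [k = 0] the online data are
explained by every system. *)
Lemma mem_match_compatible (R : realType) (n m p : nat)
    (A : 'I_p -> 'M[R]_n) (B : 'I_p -> 'M[R]_(n, m)) (sigma : nat -> 'I_p)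
    (D : 'I_p -> data R n m) (umax : R) (t0 N : nat)
    (x : nat -> 'cV[R]_n) (u : nat -> 'cV[R]_m) (match_ : nat -> {set 'I_p}) :
  (forall i, Sigma (D i) (A i) (B i)) ->
  mode_detection_run A B sigma D umax t0 N x u match_ ->
  forall k i, (k <= N)%N ->
  reflect (compatible (online x u t0 k) (D i)) (i \in match_ k).
Proof.
move=> hD run; elim=> [|k IHk] i kN.
  rewrite (run_init run) inE; constructor.
  by exists (A i), (B i); split=> //; apply/Sigma_online.
rewrite (run_match run) // inE andbC.
apply: (iffP andP) => [[/kernel_testP //] | comp].
split; first exact/kernel_testP.
apply/(IHk i (ltnW kN)); case: comp => A' [B' [/Sigma_online Son SD]].
by exists A', B'; split=> //; apply/Sigma_online => j jk; apply/Son/ltnW.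
Qed.

(* The term (x t0 == 0) : nat is 1 if the algorithm is started at the zero
   state and 0 otherwise. From the zero state the first execution applies the
   zero input and yields no information. *)
Theorem mainTheorem3 (R : realType) (n m p : nat) (lambda umax : R)
    (hlambda : 0 < lambda < 1) (humax : 0 < umax)
    (A : 'I_p -> 'M[R]_n) (B : 'I_p -> 'M[R]_(n, m))
    (D : 'I_p -> data R n m)
    (hD : forall i, Sigma (D i) (A i) (B i))
    (hstab : forall i, informative_stabilization lambda (D i))
    (hctrl : forall i, controllable (A i) (B i))
    (hincomp : forall i j, i <> j -> ~ compatible (D i) (D j))
    (sigma : nat -> 'I_p) (t0 N : nat)
    (x : nat -> 'cV[R]_n) (u : nat -> 'cV[R]_m) (match_ : nat -> {set 'I_p})
    (hdwell : forall k, (k < N)%N -> sigma (t0 + k)%N = sigma t0)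
    (hrun : mode_detection_run A B sigma D umax t0 N x u match_) :
  (N <= n + m + (x t0 == 0)%R)%N /\
  (if #|match_ N| == 1%N
   then informative_mode_detection D (online x u t0 N)
   else exists v : 'cV[R]_m, input_rule umax (online x u t0 N) v).
Proof.
set s := sigma t0.
have Son k : (k <= N)%N -> Sigma (online x u t0 k) (A s) (B s).
  move=> kN; apply/Sigma_online => j jk; have jN := leq_trans jk kN.
  by rewrite (run_state hrun) // hdwell.
have matchP := mem_match_compatible hD hrun.
have s_match k : (k <= N)%N -> s \in match_ k.
  by move=> kN; apply/matchP => //; exists (A s), (B s); split; [exact: Son|].
(* With full row rank the true system is the only one explaining the online
   data, so it also explains the data of every matching mode. *)
have identified k : (k <= N)%N -> row_free (regressor (online x u t0 k)) ->
    #|match_ k| = 1.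
  move=> kN free; suff -> : match_ k = [set s] by rewrite cards1.
  apply/setP => i; rewrite inE; apply/idP/eqP => [|->]; last exact: s_match.
  case/(matchP _ _ kN) => A' [B' [S' SD]].
  have [AE BE] := Sigma_unique free (Son k kN) S'.
  apply/eqP/negP => /negP /eqP /hincomp; apply.
  by exists A', B'; split=> //; rewrite -AE -BE.
split.
  rewrite leqNgt; apply/negP => ltN; apply: (run_continue hrun ltN).
  apply: identified (ltnW ltN) _; rewrite /row_free eqn_leq rank_leq_row /=.
  by have := regressor_online_rank (run_input hrun) (ltnW ltN); rewrite leq_add2r.
case: ifP => [/cards1P[i matchE] | /eqP not1].
  exists i; split; first by apply/(matchP _ _ (leqnn N)); rewrite matchE inE.
  by move=> j /(matchP _ _ (leqnn N)); rewrite matchE inE => /eqP.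
apply: input_rule_feasible humax (hctrl s) (Son N (leqnn N)) _.
by apply/negP => /(identified N (leqnn N)).
Qed.
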